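(* Let $G$ be a connected graph (without loops) and let $H:V(G)\to 2^{\mathbb{N}}$ be such that $(G,H)$ is dense. Then $G$ has an $H$-orientation if and only if there is no parity trace $(x_1,\dots,x_k)$ of $(G,H)$ for which $|V^1|\not\equiv e(G)\pmod 2$.
   Context: An orientation $O$ of $G$ assigns a direction to each edge; $d^+_O(v)$ is the out-degree of $v$. For $H:V(G)\to 2^{\mathbb{N}}$, an $H$-orientation is an orientation $O$ with $d^+_O(v)\in H(v)$ for all $v$. The pair $(G,H)$ is called dense if $G$ is connected and for every $v\in V(G)$ and every integer $i$ with $0\le i\le d_G(v)-1$: if $i\notin H(v)$ then $i+1\in H(v)$. For $S\subseteq V(G)$, $e(S)$ is the number of edges of $G[S]$, $e(G)=|E(G)|$, and $d_G(x,S)$ is the number of edges joining $x$ to vertices of $S$. Say $H(x)$ is odd (resp. even) if $H(x)\cap[0,d_G(x)]$ is nonempty and consists only of odd (resp. even) integers. Let $V^1_0=\{x: H(x)\text{ is odd}\}$, $V^2_0=\{x: H(x)\text{ is even}\}$. An ordering $(x_1,\dots,x_k)$ of $V(G)\setminus(V^1_0\cup V^2_0)$ is a parity trace if, defining recursively for $i=1,\dots,k$: $l_i$ = the number of components $C$ of $G-x_i$ with $V(C)\subseteq V^1_{i-1}\cup V^2_{i-1}$ and $|V(C)\cap V^1_{i-1}|+e(C)\not\equiv d_G(x_i,V(C))\pmod 2$; $t_i$ = the number of components $C$ of $G-x_i$ with $V(C)\subseteq V^1_{i-1}\cup V^2_{i-1}$ and $|V(C)\cap V^1_{i-1}|\not\equiv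 e(C)\pmod 2$; $u_i=d_G(x_i)-t_i$, it holds that all elements of $[l_i,u_i]\cap H(x_i)$ have the same parity (where $[s,t]=\{s,s+1,\dots,t\}$); and then $V^1_i=V^1_{i-1}\cup\{x_i\}$, $V^2_i=V^2_{i-1}$ if these elements are odd, $V^1_i=V^1_{i-1}$, $V^2_i=V^2_{i-1}\cup\{x_i\}$ if they are even (if $[l_i,u_i]\cap H(x_i)=\emptyset$, either choice is allowed). For a parity trace, $V^1:=V^1_k$. *)

(* Defs.v *)
From mathcomp Require Import all_boot.
From mathcomp Require Import boolp.

Set Implicit Arguments.
Unset Strict Implicit.
Unset Printing Implicit Defensive.

(* Finite loopless graphs. Distinct edges may have the same ends (parallel
   edges); loops are excluded because every edge has two distinct ends. *)
Record graph := Graph {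
  vertex : finType;
  edge : finType;
  ends : edge -> {set vertex};
  card_ends : forall e : edge, #|ends e| = 2
}.

Section GraphTheory.
Variable G : graph.
Implicit Types (x y v : vertex G) (S : {set vertex G}).

Definition adj : rel (vertex G) :=
  fun x y => [exists e : edge G, ends e == [set x; y]].

Definition connected : Prop :=
  0 < #|vertex G| /\ forall x y, connect adj x y.

Definition adj_in S : rel (vertex G) :=
  fun x y => [&& x \in S, y \in S & adj x y].

(* Vertex sets of the connected components of the induced subgraph G[S]. *)
Definition components S : {set {set vertex G}} :=
  equivalence_partition (connect (adj_in S)) S.

Definition deg v : nat := #|[set e : edge G | v \in ends e]|.

Definition deg_to x S : nat :=
  #|[set e : edge G | [exists y in S, ends e == [set x; y]]]|.

Definition num_edges_in S : nat := #|[set e : edge G | ends e \subset S]|.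

Definition num_edges : nat := #|edge G|.

(* [O e] is the pair (tail, head) of the edge [e]. *)
Definition orientation (O : edge G -> vertex G * vertex G) : Prop :=
  forall e, ends e = [set (O e).1; (O e).2].

Definition outdeg (O : edge G -> vertex G * vertex G) v : nat :=
  #|[set e : edge G | (O e).1 == v]|.

(* [H v i] reads "i belongs to H(v)". *)
Variable H : vertex G -> nat -> Prop.

Definition H_orientation (O : edge G -> vertex G * vertex G) : Prop :=
  orientation O /\ forall v, H v (outdeg O v).

Definition dense : Prop :=
  connected /\ forall v i, i < deg v -> ~ H v i -> H v i.+1.

Definition H_odd x : Prop :=
  (exists2 i, i <= deg x & H x i) /\
  (forall i, i <= deg x -> H x i -> odd i).

Definition H_even x : Prop :=
  (exists2 i, i <= deg x & H x i) /\
  (forall i, i <= deg x -> H x i -> ~~ odd i).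

Definition V1_init : {set vertex G} := [set x | `[< H_odd x >]].
Definition V2_init : {set vertex G} := [set x | `[< H_even x >]].

Definition trace_l (V1 V2 : {set vertex G}) x : nat :=
  #|[set C in components (~: [set x]) | (C \subset V1 :|: V2) &&
      (#|C :&: V1| + num_edges_in C != deg_to x C %[mod 2])]|.

Definition trace_t (V1 V2 : {set vertex G}) x : nat :=
  #|[set C in components (~: [set x]) | (C \subset V1 :|: V2) &&
      (#|C :&: V1| != num_edges_in C %[mod 2])]|.

(* i \in [l, u] for u = deg x - t, written without truncated subtraction. *)
Definition in_window (V1 V2 : {set vertex G}) x (i : nat) : Prop :=
  trace_l V1 V2 x <= i /\ i + trace_t V1 V2 x <= deg x.

(* [trace_steps V1 V2 xs W1 W2]: processing the vertices of xs in order turns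
   the pair (V1, V2) into (W1, W2). Both step constructors apply when the
   window does not meet H(x), so that either choice is then allowed. *)
Inductive trace_steps (V1 V2 : {set vertex G}) :
    seq (vertex G) -> {set vertex G} -> {set vertex G} -> Prop :=
| trace_nil : trace_steps V1 V2 [::] V1 V2
| trace_odd x xs W1 W2 :
    (forall i, in_window V1 V2 x i -> H x i -> odd i) ->
    trace_steps (x |: V1) V2 xs W1 W2 ->
    trace_steps V1 V2 (x :: xs) W1 W2
| trace_even x xs W1 W2 :
    (forall i, in_window V1 V2 x i -> H x i -> ~~ odd i) ->
    trace_steps V1 (x |: V2) xs W1 W2 ->
    trace_steps V1 V2 (x :: xs) W1 W2.

(* The ordering xs is a parity trace, with final sets V^1 = W1, V^2 = W2. *)
Definition parity_trace (xs : seq (vertex G)) (W1 W2 : {set vertex G}) : Prop :=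
  [/\ uniq xs, xs =i ~: (V1_init :|: V2_init)
    & trace_steps V1_init V2_init xs W1 W2].

End GraphTheory.

(* Main.v *)
Require Import Defs.
From mathcomp Require Import all_boot.
From mathcomp Require Import boolp zify.

Set Implicit Arguments.
Unset Strict Implicit.
Unset Printing Implicit Defensive.

(* Call a vertex good when its out-degree lies in H. By density, flipping an
   edge at a bad vertex makes it good, so badness can be moved along paths, and
   inside a connected vertex set S all vertices but a prescribed one can be made
   good without touching the edges outside G[S].

   Along a parity trace, every nonempty set C of processed vertices has a pivot,
   namely the vertex y of C processed last: as soon as all the other processed
   vertices are good, all the other vertices of C have the parities assigned to
   them, and y is good exactly when it has its own. Let C be a component of
   G - x consisting of processed vertices. Summing the out-degrees over C shows
   that, once C is good, the parity of the number of arcs from x to C is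
   determined, so that the out-degree of x lies in the window [l, u]; moreover,
   concentrating the badness of C at its pivot shows that every number of arcs
   of that parity occurs with C good. For an arbitrary component C of G - x and
   every j < d(x, C), one of j and j + 1 arcs from x to C occurs with C good.

   By density, the part of H(x) in the window either contains two consecutive
   integers or is one of the two parity classes of the window. In the first
   case, if x is chosen so that at most one component of G - x contains
   unprocessed vertices, then one of the two integers is the out-degree of x in
   an H-orientation. In the second case, x can be processed. Once all vertices
   are processed, the sum e(G) of the out-degrees either has the parity of
   |V^1|, and then concentrating the badness at the pivot of V(G) gives an
   H-orientation, or the parity trace is the desired obstruction. *)

Section FiniteSets.
Variable T : finType.
Implicit Types (x y : T) (A B : {set T}) (F c lo hi : T -> nat).

Lemma card_set_sum (P : pred T) : #|[set x | P x]| = \sum_x P x.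
Proof. by rewrite -sum1dep_card big_mkcond. Qed.

Lemma card_setId_sum A (P : pred T) :
  #|[set x in A | P x]| = \sum_(x in A) P x.
Proof. by rewrite -sum1dep_card big_mkcondr. Qed.

Lemma odd_sum (I : Type) (r : seq I) (P : pred I) (F : I -> nat) :
  odd (\sum_(i <- r | P i) F i) = \big[addb/false]_(i <- r | P i) odd (F i).
Proof. exact: (big_morph odd oddD). Qed.

Lemma odd_sum_mem A B F : {in A, forall x, odd (F x) = (x \in B)} ->
  odd (\sum_(x in A) F x) = odd #|A :&: B|.
Proof.
move=> oddF; have -> : #|A :&: B| = \sum_(x in A) (x \in B).
  exact: card_setId_sum.
by rewrite !odd_sum; apply: eq_bigr => x xA; rewrite oddF // oddb.
Qed.

Lemma odd_sum_mem_last A B F y : y \in A ->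
  {in A :\ y, forall x, odd (F x) = (x \in B)} ->
  odd (\sum_(x in A) F x) = odd #|A :&: B| -> odd (F y) = (y \in B).
Proof.
move=> yA oddF; rewrite (big_setD1 y) //= (cardsD1 y) inE yA !oddD oddb.
by rewrite (odd_sum_mem oddF) setIDAC => /addIb.
Qed.

Lemma exists_sum_leq A c n : n <= \sum_(x in A) c x ->
  exists2 f : T -> nat, (forall x, f x <= c x) & \sum_(x in A) f x = n.
Proof.
elim: n => [|n IH] lt_n; first by exists (fun=> 0) => //; rewrite big1.
have [f fc sumf] := IH (ltnW lt_n).
have [x xA lt_fc] : exists2 x, x \in A & f x < c x.
  apply/exists_inP; apply: contraTT lt_n => /exists_inPn ge_fc.
  by rewrite -leqNgt -sumf; apply: leq_sum => x /ge_fc; rewrite -leqNgt.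
exists (fun y => f y + (y == x)) => [y|].
  by case: eqP => [->|_]; rewrite ?addn1 ?addn0.
rewrite big_split sumf (bigD1 x) //= eqxx big1 ?addn0 ?addn1 //.
by move=> y /andP[_ /negbTE->].
Qed.

Lemma exists_sum_same_parity A lo hi n :
  {in A, forall x, lo x <= hi x} -> {in A, forall x, odd (lo x) = odd (hi x)} ->
  \sum_(x in A) lo x <= n <= \sum_(x in A) hi x ->
  odd n = odd (\sum_(x in A) lo x) ->
  exists2 f : T -> nat,
    {in A, forall x, lo x <= f x <= hi x /\ odd (f x) = odd (lo x)} &
    \sum_(x in A) f x = n.
Proof.
move=> le_lohi odd_lohi.
have -> : \sum_(x in A) hi x =
    \sum_(x in A) lo x + 2 * \sum_(x in A) (hi x - lo x)./2.
  rewrite big_distrr -big_split /=; apply: eq_bigr => x xA.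
  by have := le_lohi x xA; have := odd_lohi x xA; lia.
move=> bound_n odd_n.
have [|g gle sumg] := @exists_sum_leq A (fun x => (hi x - lo x)./2)
  (n - \sum_(x in A) lo x)./2; first by lia.
exists (fun x => lo x + 2 * g x) => [x xA|].
  by have := gle x; have := le_lohi x xA; lia.
by rewrite big_split -big_distrr sumg /=; lia.
Qed.

Definition setU1_if (p : bool) x A : {set T} := if p then x |: A else A.

Lemma in_setU1_if p x A y : (y \in setU1_if p x A) = p && (y == x) || (y \in A).
Proof. by rewrite /setU1_if; case: p; rewrite ?inE. Qed.

Lemma setU1_if_setU p x A B :
  setU1_if p x A :|: setU1_if (~~ p) x B = x |: (A :|: B).
Proof. by rewrite /setU1_if; case: p; [rewrite -setUA|rewrite setUCA]. Qed.

End FiniteSets.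

Lemma neq_mod2 m n : (m != n %[mod 2]) = odd (m + n).
Proof. by rewrite !modn2 oddD; case: (odd m); case: (odd n). Qed.

Lemma no_gap_parity (A : nat -> Prop) m n :
  (forall i, m <= i < n -> ~ A i -> A i.+1) ->
  (exists i, [/\ m <= i < n, A i & A i.+1]) \/
  (exists p, forall i, m <= i <= n -> A i <-> odd i = p).
Proof.
move=> gapA; have [|noC] := pselect (exists i, [/\ m <= i < n, A i & A i.+1]).
  by left.
right; pose p := if `[< A m >] then odd m else ~~ odd m; exists p => i /andP[].
have Am : A m <-> odd m = p by rewrite /p; case: asboolP; case: (odd m).
elim: i => [|i IH]; first by rewrite leqn0 => /eqP<-.
rewrite leq_eqVlt => /predU1P[<- //|lt_mi lt_in].
have AS : A i.+1 <-> ~ A i.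
  split=> [AiS Ai|]; [apply: noC; exists i; split=> //|apply: gapA => //]; lia.
by rewrite AS (IH lt_mi (ltnW lt_in)) oddS; case: (odd i); case: (p); split.
Qed.

Section Components.
Variable G : graph.
Local Notation V := (vertex G).
Implicit Types (x y z : V) (e : edge G) (S C K : {set V}).

Definition meets e C : bool := ~~ [disjoint ends e & C].

Lemma mem_meets e C x : x \in ends e -> x \in C -> meets e C.
Proof. by move=> xe xC; apply/pred0Pn; exists x; rewrite /= xe. Qed.

Lemma meetsP e C : reflect (exists2 x, x \in ends e & x \in C) (meets e C).
Proof.
by apply: (iffP pred0Pn) => [[x /andP[]]|[x xe xC]]; exists x; rewrite //= xe.
Qed.

Lemma ends_neq e x y : ends e = [set x; y] -> x != y.
Proof. by move=> eE; have := card_ends e; rewrite eE cards2; case: eqVneq. Qed.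

Lemma ends_set2 e x y :
  x \in ends e -> y \in ends e -> x != y -> ends e = [set x; y].
Proof.
move=> xe ye xy; apply/esym/eqP; rewrite eqEcard card_ends cards2 xy andbT.
by rewrite subUset !sub1set xe.
Qed.

Lemma ends_adj e x y : ends e = [set x; y] -> adj x y.
Proof. by move=> eE; apply/existsP; exists e; rewrite eE. Qed.

Lemma adj_sym : symmetric (@adj G).
Proof. by move=> x y; apply: eq_existsb => e; rewrite setUC. Qed.

Lemma adj_in_connect_sym S : connect_sym (adj_in S).
Proof.
by apply: sym_connect_sym => x y; rewrite /adj_in adj_sym andbCA.
Qed.

Lemma connect_adj_inS S C x y :
  C \subset S -> connect (adj_in C) x y -> connect (adj_in S) x y.
Proof.
move=> /subsetP sCS; apply: connect_sub => u v /and3P[uC vC uv].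
by apply: connect1; rewrite /adj_in !sCS.
Qed.

Lemma connect_adj_inT x y : connected G -> connect (adj_in [set: V]) x y.
Proof.
case=> _ /(_ x y); apply: connect_sub => u v uv.
by apply: connect1; rewrite /adj_in !inE.
Qed.

Lemma mem_component S C x y : C \in components S -> x \in C ->
  (y \in C) = (y \in S) && connect (adj_in S) x y.
Proof.
case/imsetP=> z _ ->; rewrite !inE => /andP[_ zx].
by rewrite (same_connect (adj_in_connect_sym S) zx).
Qed.

Lemma component_sub S C : C \in components S -> C \subset S.
Proof.
by case/imsetP=> z _ ->; apply/subsetP => y; rewrite inE => /andP[].
Qed.

Lemma component_neq0 S C : C \in components S -> C != set0.
Proof.
case/imsetP=> z zS ->; apply/set0Pn; exists z.
by rewrite inE zS connect0.
Qed.

Lemma componentP S x : x \in S -> exists2 C, C \in components S & x \in C.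
Proof.
move=> xS; exists [set y in S | connect (adj_in S) x y].
  exact: imset_f.
by rewrite inE xS connect0.
Qed.

Lemma component_eq S C K x :
  C \in components S -> K \in components S -> x \in C -> x \in K -> C = K.
Proof.
move=> CS KS xC xK; apply/setP => y.
by rewrite (mem_component _ CS xC) (mem_component _ KS xK).
Qed.

Lemma component_adj S C x y :
  C \in components S -> x \in C -> y \in S -> adj x y -> y \in C.
Proof.
move=> CS xC yS xy; rewrite (mem_component _ CS xC) yS; apply: connect1.
by rewrite /adj_in (subsetP (component_sub CS)) // yS.
Qed.

Lemma component_connect S C : C \in components S ->
  {in C &, forall x y, connect (adj_in C) x y}.
Proof.
move=> CS x y xC; rewrite (mem_component _ CS xC) => /andP[_ /connectP[p]].
elim: p x xC => [|z p IH] x xC /=; first by move=> _ ->.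
case/andP=> /and3P[_ zS xz] pathp lastp.
have zC := component_adj CS xC zS xz.
apply: connect_trans (IH z zC pathp lastp).
by apply: connect1; rewrite /adj_in xC zC.
Qed.

Lemma meets_component_eq S C K e : C \in components S -> K \in components S ->
  meets e C -> meets e K -> C = K.
Proof.
move=> CS KS /meetsP[u ue uC] /meetsP[v ve vK].
have [uv|uv] := eqVneq u v; first by apply: (component_eq CS KS uC); rewrite uv.
apply: (component_eq CS KS _ vK); apply: (component_adj CS uC).
  exact: (subsetP (component_sub KS)).
by apply: (@ends_adj e); exact: ends_set2.
Qed.

Lemma sum_mem_components S x : \sum_(K in components S) (x \in K) = (x \in S).
Proof.
have [xS|xS] := boolP (x \in S); last first.
  rewrite big1 // => K KS; apply/eqP; rewrite eqb0; apply: contra xS.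
  exact/subsetP/component_sub.
have [C CS xC] := componentP xS; rewrite (bigD1 C) //= xC big1 // => K.
case/andP=> KS; apply: contraNeq; rewrite eqb0 negbK => xK.
exact/eqP/(component_eq KS CS xK).
Qed.

Section Deletion.
Variable x : V.

Lemma notin_component C : C \in components (~: [set x]) -> x \notin C.
Proof.
by move=> /component_sub/subsetP sC; apply/negP => /sC; rewrite !inE eqxx.
Qed.

Lemma component_neighbor C : connected G -> C \in components (~: [set x]) ->
  exists2 z, z \in C & adj x z.
Proof.
move=> [_ cG] CS; have /set0Pn[z zC] := component_neq0 CS.
apply/exists_inP; apply: contraT => /exists_inPn nadj.
have clC : closed (@adj G) C.
  apply: intro_closed => [|u v uv uC]; first exact/sym_connect_sym/adj_sym.
  apply: (component_adj CS uC _ uv); rewrite !inE.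
  by apply: contraNneq (nadj u uC) => <-; rewrite adj_sym.
have := closed_connect clC (cG z x).
by rewrite zC (negbTE (notin_component CS)).
Qed.

Lemma component_setU1_connect C : connected G ->
  C \in components (~: [set x]) ->
  {in C, forall y, connect (adj_in (x |: C)) y x}.
Proof.
move=> cG CS y yC; have [z zC xz] := component_neighbor cG CS.
apply: connect_trans (connect_adj_inS (subsetU1 _ _) _) _.
  exact: component_connect CS _ _ yC zC.
by apply: connect1; rewrite /adj_in adj_sym xz !inE eqxx zC orbT.
Qed.

Lemma setC_component_connect C : connected G ->
  C \in components (~: [set x]) ->
  {in ~: C, forall y, connect (adj_in (~: C)) y x}.
Proof.
move=> cG CS y; rewrite inE => yC; have [->//|yx] := eqVneq y x.
have [|K KS yK] := @componentP (~: [set x]) y; first by rewrite !inE.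
apply: connect_adj_inS (component_setU1_connect cG KS yK).
apply/subsetP => z; rewrite !inE => /predU1P[->|zK].
  exact: notin_component.
by apply: contra yC => zC; rewrite (component_eq CS KS zC zK).
Qed.

End Deletion.

(* Maximise the size of [C] over the pairs of a vertex [x] outside [P] and a
   component [C] of [G - x] not contained in [P].  If another component of
   [G - x] had a vertex [y] outside [P], then the component of [G - y]
   containing [x] would be larger. *)
Lemma exists_extremal_vertex (P : {set V}) : connected G -> P != setT ->
  exists2 x, x \notin P &
    #|[set K in components (~: [set x]) | ~~ (K \subset P)]| <= 1.
Proof.
move=> cG; rewrite -subTset => /subsetPn[r _ rP].
pose outer x := [set K in components (~: [set x]) | ~~ (K \subset P)].
case: (pickP [pred u | (u.1 \notin P) && (u.2 \in outer u.1)]); last first.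
  move=> none; exists r => //; apply: leqW; rewrite leqn0 cards_eq0 -subset0.
  by apply/subsetP => K KO; have := none (r, K); rewrite /= rP KO.
move=> u0 u0P; case: (arg_maxnP (fun u : V * {set V} => #|u.2|) u0P).
case=> x C /andP[/= xP CO] max_C; exists x => //.
have /setIdP[CS _] := CO.
rewrite -(cards1 C); apply/subset_leq_card/subsetP => K /setIdP[KS].
case/subsetPn=> y yK yP; rewrite inE; apply: contraT => KC.
have yC : y \notin C.
  by apply: contra KC => yC; rewrite (component_eq KS CS yK yC).
have xy : x != y by apply: contraNneq (notin_component KS) => ->.
have [|D DS xD] := @componentP (~: [set y]) x; first by rewrite !inE.
have sCy : x |: C \subset ~: [set y].
  by rewrite subUset sub1set subsetC sub1set !inE xy.
have sCD : x |: C \subset D.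
  apply/subsetP => z zC; rewrite (mem_component _ DS xD) (subsetP sCy) //=.
  rewrite adj_in_connect_sym; apply: connect_adj_inS sCy _.
  by have [->|/component_setU1_connect->] := setU1P zC.
have DP : ~~ (D \subset P) by apply/subsetPn; exists x.
have := max_C (y, D); rewrite /= yP inE DS DP => /(_ isT).
move/(leq_trans (subset_leq_card sCD)).
by rewrite cardsU1 notin_component // ltnn.
Qed.

End Components.

Section Orientations.
Variable G : graph.
Local Notation V := (vertex G).
Local Notation E := (edge G).
Implicit Types (O : E -> V * V) (x y v : V) (e f : E) (A B C S : {set V}).

Definition reverse O : E -> V * V := fun e => ((O e).2, (O e).1).

Definition flip e O : E -> V * V :=
  fun f => if f == e then reverse O f else O f.

Definition arcs O A B : nat := #|[set e | ((O e).1 \in A) && ((O e).2 \in B)]|.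

Lemma arcsE O A B :
  arcs O A B = \sum_e ((O e).1 \in A) && ((O e).2 \in B).
Proof. exact: card_set_sum. Qed.

Lemma orientation_reverse O : orientation O -> orientation (reverse O).
Proof. by move=> oO e; rewrite oO setUC. Qed.

Lemma orientation_flip e O : orientation O -> orientation (flip e O).
Proof.
by move=> oO f; rewrite /flip; case: eqP => _; [apply: orientation_reverse|].
Qed.

Lemma orientation_neq O e : orientation O -> (O e).1 != (O e).2.
Proof. by move/(_ e)/ends_neq. Qed.

Lemma tail_in_ends O e : orientation O -> (O e).1 \in ends e.
Proof. by move->; rewrite !inE eqxx. Qed.

Lemma head_in_ends O e : orientation O -> (O e).2 \in ends e.
Proof. by move->; rewrite !inE eqxx orbT. Qed.

Lemma exists_orientation : exists O, orientation O.
Proof.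
apply: (@fin_all_exists _ (fun=> _) (fun e p => ends e = [set p.1; p.2])) => e.
have /eqP/cards2P[x [y [_ ->]]] := card_ends e.
by exists (x, y).
Qed.

(* Every edge meets at most one component, so orientations can be prescribed
   independently on the sets of edges meeting each component. *)
Lemma glue_components S (F : {set V} -> E -> V * V) :
  {in components S, forall K, orientation (F K)} ->
  exists2 O, orientation O &
    forall K e, K \in components S -> meets e K -> O e = F K e.
Proof.
move=> oF.
pose P e (p : V * V) := ends e = [set p.1; p.2] /\
  forall K, K \in components S -> meets e K -> p = F K e.
have /fin_all_exists[O OP] : forall e, exists p, P e p.
  move=> e; case: (pickP [pred K in components S | meets e K]) => [K|none].
    case/andP=> /= KS eK; exists (F K e); split=> [|L LS eL]; first exact: oF.
    by rewrite (meets_component_eq KS LS eK eL).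
  have [O oO] := exists_orientation; exists (O e); split=> // K KS eK.
  by have := none K; rewrite /= KS eK.
by exists O => [e|K e KS eK]; have [oe] := OP e; last exact.
Qed.

Lemma eq_arcs O O' A B : orientation O -> orientation O' ->
  (forall e, meets e A -> meets e B -> O' e = O e) -> arcs O' A B = arcs O A B.
Proof.
have arc_meets Q e : orientation Q -> (Q e).1 \in A -> (Q e).2 \in B ->
    meets e A && meets e B.
  move=> oQ tA hB.
  by rewrite (mem_meets (tail_in_ends e oQ)) ?(mem_meets (head_in_ends e oQ)).
move=> oO oO' eqO; apply: eq_card => e; rewrite !inE.
apply/andP/andP=> -[tA hB].
  by have /andP[eA eB] := arc_meets O' e oO' tA hB; rewrite -(eqO e).
by have /andP[eA eB] := arc_meets O e oO tA hB; rewrite (eqO e).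
Qed.

Lemma arcs_flip O e A B :
  arcs (flip e O) A B + ((O e).1 \in A) && ((O e).2 \in B) =
  arcs O A B + ((O e).2 \in A) && ((O e).1 \in B).
Proof.
pose arc Q f : nat := ((Q f).1 \in A) && ((Q f).2 \in B).
have same : \sum_(f | f != e) arc (flip e O) f = \sum_(f | f != e) arc O f.
  by apply: eq_bigr => f /negbTE fe; rewrite /arc /flip fe.
rewrite !arcsE (bigD1 e) //= [in RHS](bigD1 e) //= same /flip eqxx /=.
by rewrite addnAC [RHS]addnAC; congr (_ + _); rewrite addnC.
Qed.

Lemma sum_arcs_components O A S :
  \sum_(K in components S) arcs O A K = arcs O A S.
Proof.
under eq_bigr do rewrite arcsE.
rewrite exchange_big arcsE; apply: eq_bigr => e _ /=.
by case: (_ \in A); rewrite ?sum_mem_components ?big1.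
Qed.

Lemma outdeg_arcs O v : outdeg O v = arcs O [set v] setT.
Proof. by apply: eq_card => e; rewrite !inE andbT. Qed.

Lemma outdeg_arcs_setC O v : orientation O ->
  outdeg O v = arcs O [set v] (~: [set v]).
Proof.
move=> oO; apply: eq_card => e; rewrite !inE.
by case: eqVneq => //= <-; rewrite eq_sym orientation_neq.
Qed.

Lemma outdeg_flip O e v : orientation O -> v \in ends e ->
  outdeg (flip e O) v = (outdeg O v).+1 \/
  outdeg O v = (outdeg (flip e O) v).+1.
Proof.
move=> oO; rewrite (oO e) !inE !outdeg_arcs => ve.
have := arcs_flip O e [set v] setT; rewrite !inE !andbT.
have /negbTE neq := orientation_neq e oO.
case/orP: ve => /eqP->; rewrite eqxx; first by rewrite eq_sym neq; right; lia.
by rewrite neq; left; lia.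
Qed.

Lemma eq_outdeg O O' v : orientation O -> orientation O' ->
  (forall e, v \in ends e -> O' e = O e) -> outdeg O' v = outdeg O v.
Proof.
move=> oO oO' eqO; rewrite !outdeg_arcs; apply: eq_arcs => // e.
by case/meetsP=> w we /set1P wv _; apply: eqO; rewrite -wv.
Qed.

Lemma deg_outdeg O v : orientation O ->
  deg v = outdeg O v + outdeg (reverse O) v.
Proof.
move=> oO; rewrite /deg /outdeg !card_set_sum -big_split.
apply: eq_bigr => e _; rewrite (oO e) !inE !(eq_sym v) /=.
have [<-|//] := eqVneq (O e).1 v.
by rewrite eq_sym (negbTE (orientation_neq e oO)).
Qed.

Lemma outdeg_leq_deg O v : orientation O -> outdeg O v <= deg v.
Proof. by move/deg_outdeg->; exact: leq_addr. Qed.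

Lemma deg_to_arcs O x C : orientation O ->
  deg_to x C = arcs O [set x] C + arcs O C [set x].
Proof.
move=> oO; rewrite /deg_to card_set_sum !arcsE -big_split.
apply: eq_bigr => e _; rewrite !inE /=; have neq := orientation_neq e oO.
have -> : [exists y in C, ends e == [set x; y]] =
    ((O e).1 == x) && ((O e).2 \in C) || ((O e).1 \in C) && ((O e).2 == x).
  apply/exists_inP/orP => [[y yC /eqP eE]|].
    have := tail_in_ends e oO; have := head_in_ends e oO.
    rewrite eE !inE => /orP[]/eqP hE /orP[]/eqP tE; move: neq;
      rewrite hE tE ?eqxx // yC; by [left|right].
  case=> /andP[]; first by move=> /eqP<- hC; exists (O e).2; rewrite ?oO.
  by move=> tC /eqP<-; exists (O e).1; rewrite // oO setUC.
by have [tx|] //= := eqVneq; rewrite -tx eq_sym (negbTE neq) andbF orbF addn0.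
Qed.

Lemma deg_components x : deg x = \sum_(K in components (~: [set x])) deg_to x K.
Proof.
have [O oO] := exists_orientation; have oR := orientation_reverse oO.
under eq_bigr do rewrite (deg_to_arcs _ _ oO).
rewrite (deg_outdeg x oO) (outdeg_arcs_setC x oO) (outdeg_arcs_setC x oR).
rewrite -!sum_arcs_components -big_split; apply: eq_bigr => K _ /=.
by congr (_ + _); apply: eq_card => e; rewrite !inE andbC.
Qed.

Lemma sum_outdeg O C : \sum_(v in C) outdeg O v = arcs O C setT.
Proof.
rewrite /arcs -sum1dep_card (partition_big (fun e => (O e).1) (mem C)) /=.
  apply: eq_bigr => v vC; rewrite /outdeg -sum1dep_card.
  apply: eq_bigl => e; rewrite inE andbT andbC.
  by case: eqP => // ->; rewrite vC.
by move=> e /andP[].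
Qed.

Lemma sum_outdegT O : \sum_(v in [set: V]) outdeg O v = num_edges G.
Proof. by rewrite sum_outdeg; apply: eq_card => e; rewrite !inE. Qed.

Lemma deg_to_gt0 x C : connected G -> C \in components (~: [set x]) ->
  0 < deg_to x C.
Proof.
move=> cG CS; have [z zC /existsP[e eE]] := component_neighbor cG CS.
by apply/card_gt0P; exists e; rewrite inE; apply/exists_inP; exists z.
Qed.

Lemma sum_outdeg_component O x C : orientation O ->
  C \in components (~: [set x]) ->
  \sum_(v in C) outdeg O v = num_edges_in C + arcs O C [set x].
Proof.
move=> oO CS; rewrite sum_outdeg /num_edges_in card_set_sum !arcsE -big_split.
apply: eq_bigr => e _ /=; rewrite oO subUset !sub1set !inE andbT.
case tC: (_ \in C) => //=; have [hx|hx] := eqVneq (O e).2 x.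
  by rewrite hx (negbTE (notin_component CS)).
by rewrite (component_adj CS tC) ?inE ?(ends_adj (oO e)).
Qed.

Lemma exists_orientation_arcs x C j : j <= deg_to x C ->
  exists2 O, orientation O & arcs O [set x] C = j.
Proof.
case/card_geqP=> s [uniq_s <- sub_s].
pose P e (p : V * V) := ends e = [set p.1; p.2] /\
  if e \in s then p.1 = x /\ p.2 \in C else p.1 != x.
have existsP e : exists p, P e p.
  rewrite /P; case: (boolP (e \in s)) => [es|_].
    have := sub_s e es; rewrite inE.
    by case/exists_inP=> y yC /eqP eE; exists (x, y).
  have [O oO] := exists_orientation.
  have [tx|] := eqVneq (O e).1 x; last by exists (O e).
  exists (reverse O e); split; first exact: orientation_reverse.
  by rewrite /= -tx eq_sym orientation_neq.
have [O OP] := fin_all_exists existsP.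
exists O => [e|]; first by have [] := OP e.
rewrite -(card_uniqP uniq_s); apply: eq_card => e; rewrite !inE.
have [_] := OP e; case: ifP => _; first by case=> -> ->; rewrite eqxx.
by move/negbTE->.
Qed.

End Orientations.

Section Goodness.
Variables (G : graph) (H : vertex G -> nat -> Prop).
Local Notation V := (vertex G).
Local Notation E := (edge G).
Implicit Types (O : E -> V * V) (x y v : V) (e : E) (C K S : {set V}).

Definition good O v : bool := `[< H v (outdeg O v) >].

Lemma goodP O v : reflect (H v (outdeg O v)) (good O v).
Proof. exact: asboolP. Qed.

Lemma eq_good O O' v : orientation O -> orientation O' ->
  (forall e, v \in ends e -> O' e = O e) -> good O' v = good O v.
Proof. by move=> oO oO' eqO; rewrite /good (eq_outdeg oO oO' eqO). Qed.

Lemma good_flip_notin O e v : orientation O -> v \notin ends e ->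
  good (flip e O) v = good O v.
Proof.
move=> oO ve; apply: eq_good => // [|f vf]; first exact: orientation_flip.
by rewrite /flip; case: eqP vf ve => // -> ->.
Qed.

Hypothesis dH : dense H.

Lemma good_flip O e v : orientation O -> v \in ends e ->
  ~~ good O v -> good (flip e O) v.
Proof.
move=> oO ve /goodP bad; apply/goodP.
have := outdeg_leq_deg v oO; have := outdeg_leq_deg v (orientation_flip e oO).
have [->|out_succ] := outdeg_flip oO ve.
  by move=> lt_deg _; exact: (proj2 dH).
rewrite out_succ => _ lt_deg; apply: contrapT => /(proj2 dH _ _ lt_deg).
by rewrite -out_succ.
Qed.

(* Flipping an edge at a bad vertex repairs that vertex and can spoil only the
   other end; so badness travels along paths. *)
Lemma push_bad_along_path O S x p : orientation O ->
  path (adj_in S) x p ->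
  exists O', [/\ orientation O',
    forall e, ~~ (ends e \subset S) -> O' e = O e &
    forall v, v != last x p -> ~~ good O' v -> ~~ good O v && (v != x)].
Proof.
elim: p x O => [|z p IH] x O oO /=.
  by exists O; split=> // v ->; rewrite andbT.
case/andP=> /and3P[xS zS /existsP[e /eqP eE]] pathp.
have [gx|bx] := boolP (good O x).
  by exists O; split=> // v _ bv; rewrite bv; apply: contraNneq bv => ->.
have [O' [oO' eqO' bad']] := IH z (flip e O) (orientation_flip e oO) pathp.
exists O'; split=> // [f fS|v vlast /(bad' v vlast)/andP[bv vz]].
  rewrite eqO' // /flip; case: eqP fS => // ->.
  by rewrite eE subUset !sub1set xS zS.
have vx : v != x.
  by apply: contraNneq bv => ->; apply: good_flip; rewrite // eE !inE eqxx.
by move: bv; rewrite vx andbT good_flip_notin // eE !inE negb_or vx.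
Qed.

Lemma concentrate_bad O S y : orientation O ->
  {in S, forall x, connect (adj_in S) x y} ->
  exists O', [/\ orientation O',
    forall e, ~~ (ends e \subset S) -> O' e = O e &
    {in S :\ y, forall v, good O' v}].
Proof.
move=> oO toy; have [n] := ubnP #|[set v in S :\ y | ~~ good O v]|.
elim: n O oO => // n IH O oO; rewrite ltnS => le_n.
case: (pickP [pred v in S :\ y | ~~ good O v]) => [x|none]; last first.
  exists O; split=> // v vS; have := none v.
  by rewrite inE vS => /negbFE.
case/andP=> /setD1P[xy xS] bx; have /connectP[p pathp lastp] := toy x xS.
have [O1 [oO1 eqO1 bad1]] := push_bad_along_path oO pathp.
rewrite -lastp in bad1.
have [|O2 [oO2 eqO2 good2]] := IH O1 oO1.
  apply: leq_trans le_n; apply: proper_card; apply/properP; split.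
    apply/subsetP => v /setIdP[vS bv]; rewrite inE vS.
    by have /setD1P[vy _] := vS; have /andP[] := bad1 v vy bv.
  exists x; first by rewrite inE in_setD1 xy xS.
  by apply/negP => /setIdP[_ /(bad1 x xy)]; rewrite eqxx andbF.
by exists O2; split=> // e eS; rewrite eqO2 // eqO1.
Qed.

Definition realizable x K j : Prop := exists O,
  [/\ orientation O, {in K, forall v, good O v} & arcs O [set x] K = j].

Lemma H_orientation_of_realizable x (f : {set V} -> nat) :
  {in components (~: [set x]), forall K, realizable x K (f K)} ->
  H x (\sum_(K in components (~: [set x])) f K) ->
  exists O, H_orientation H O.
Proof.
move=> realf Hx; have [O0 oO0] := exists_orientation G.
have existsF K : exists O, K \in components (~: [set x]) ->
    [/\ orientation O, {in K, forall v, good O v} & arcs O [set x] K = f K].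
  have [KS|KS] := boolP (K \in components (~: [set x])); last by exists O0.
  by have [O OP] := realf K KS; exists O.
have [F FP] := fin_all_exists existsF.
have [|O oO eqO] := @glue_components _ (~: [set x]) F.
  by move=> K /FP[].
exists O; split=> // v; have [->|vx] := eqVneq v x.
  rewrite outdeg_arcs_setC // -sum_arcs_components.
  rewrite (eq_bigr f) // => K KS; have [oK _ <-] := FP K KS.
  by apply: eq_arcs => // e _; exact: eqO.
have [|K KS vK] := @componentP _ (~: [set x]) v; first by rewrite !inE.
have [oK goodK _] := FP K KS; apply/goodP; rewrite (eq_good oK oO) ?goodK //.
by move=> e ve; apply: eqO => //; exact: mem_meets vK.
Qed.

(* Start from an orientation with exactly [j] arcs from [x] to [C], concentrate
   the badness of [C] at the tail of an arc from [C] to [x], and flip that arc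
   if its tail is still bad. *)
Lemma realizable_or_succ x C j : C \in components (~: [set x]) ->
  j < deg_to x C -> realizable x C j \/ realizable x C j.+1.
Proof.
move=> CS lt_j; have xC := notin_component CS.
have [O oO outO] := exists_orientation_arcs (ltnW lt_j).
have : 0 < arcs O C [set x].
  by move: lt_j; rewrite (deg_to_arcs _ _ oO) outO; lia.
case/card_gt0P=> e; rewrite !inE => /andP[tC /eqP hx].
have [|O1 [oO1 eqO1 good1]] := @concentrate_bad O C (O e).1 oO.
  by move=> v vC; exact: component_connect CS _ _ vC tC.
have eqx f : x \in ends f -> O1 f = O f.
  by move=> xf; apply: eqO1; apply/subsetPn; exists x.
have eqe : O1 e = O e by apply: eqx; rewrite -hx head_in_ends.
have outO1 : arcs O1 [set x] C = j.
  rewrite -outO; apply: eq_arcs => // f /meetsP[w wf /set1P wx] _.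
  by apply: eqx; rewrite -wx.
have [good_t|bad_t] := boolP (good O1 (O e).1).
  left; exists O1; split=> // v vC; have [->//|vt] := eqVneq v (O e).1.
  by apply: good1; rewrite in_setD1 vt.
right; exists (flip e O1); split; first exact: orientation_flip.
  move=> v vC; have [->|vt] := eqVneq v (O e).1.
    by apply: good_flip; rewrite // tail_in_ends.
  rewrite good_flip_notin ?good1 ?in_setD1 ?vt // oO hx !inE negb_or vt.
  by apply: contraNneq xC => <-.
have tx : (O e).1 == x = false by apply: contraNF xC => /eqP<-.
by have := arcs_flip O1 e [set x] C; rewrite outO1 eqe !inE hx eqxx tC tx; lia.
Qed.

End Goodness.

Section ParityTraces.
Variables (G : graph) (H : vertex G -> nat -> Prop).
Local Notation V := (vertex G).
Local Notation E := (edge G).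
Implicit Types (O : E -> V * V) (x y v : V) (C K : {set V}).

Definition processed (V1 V2 : {set V}) x : {set {set V}} :=
  [set K in components (~: [set x]) | K \subset V1 :|: V2].

Definition unprocessed (V1 V2 : {set V}) x : {set {set V}} :=
  [set K in components (~: [set x]) | ~~ (K \subset V1 :|: V2)].

(* The parities of the numbers of arcs from [x] to a component [K] of [G - x]
   and from [K] to [x], when [V1] is the set of vertices of odd out-degree. *)
Definition out_parity (V1 : {set V}) x K : bool :=
  #|K :&: V1| + num_edges_in K != deg_to x K %[mod 2].

Definition in_parity (V1 : {set V}) K : bool :=
  #|K :&: V1| != num_edges_in K %[mod 2].

Lemma sum_components_processed V1 V2 x (F : {set V} -> nat) :
  \sum_(K in components (~: [set x])) F K =
  \sum_(K in processed V1 V2 x) F K + \sum_(K in unprocessed V1 V2 x) F K.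
Proof.
rewrite (bigID (fun K => K \subset V1 :|: V2)).
by congr (_ + _); apply: eq_bigl => K; rewrite inE.
Qed.

Lemma trace_lE V1 V2 x :
  trace_l V1 V2 x = \sum_(K in processed V1 V2 x) out_parity V1 x K.
Proof.
by rewrite -card_setId_sum; apply: eq_card => K; rewrite !inE andbA.
Qed.

Lemma trace_tE V1 V2 x :
  trace_t V1 V2 x = \sum_(K in processed V1 V2 x) in_parity V1 K.
Proof.
by rewrite -card_setId_sum; apply: eq_card => K; rewrite !inE andbA.
Qed.

Lemma addb_out_in_parity V1 x K :
  out_parity V1 x K (+) in_parity V1 K = odd (deg_to x K).
Proof. by rewrite /out_parity /in_parity !neq_mod2 oddD addbAC addbb. Qed.

Lemma out_in_parity_leq V1 x K : connected G -> K \in components (~: [set x]) ->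
  out_parity V1 x K + in_parity V1 K <= deg_to x K.
Proof.
move=> cG /(deg_to_gt0 cG); have := addb_out_in_parity V1 x K.
by case: (out_parity V1 x K); case: (in_parity V1 K); case: deg_to => // -[].
Qed.

Lemma trace_sum_leq V1 V2 x : connected G ->
  trace_l V1 V2 x + trace_t V1 V2 x <= \sum_(K in processed V1 V2 x) deg_to x K.
Proof.
move=> cG; rewrite trace_lE trace_tE -big_split; apply: leq_sum => K.
by case/setIdP=> KS _; exact: out_in_parity_leq.
Qed.

Lemma odd_trace_sum V1 V2 x :
  odd (trace_l V1 V2 x + trace_t V1 V2 x) =
  odd (\sum_(K in processed V1 V2 x) deg_to x K).
Proof.
rewrite trace_lE trace_tE -big_split !odd_sum; apply: eq_bigr => K _.
by rewrite oddD !oddb addb_out_in_parity.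
Qed.

Lemma odd_sum_outdeg_component O V1 x K : orientation O ->
  K \in components (~: [set x]) ->
  (odd (\sum_(v in K) outdeg O v) == odd #|K :&: V1|) =
  (odd (arcs O [set x] K) == out_parity V1 x K).
Proof.
move=> oO KS; rewrite (sum_outdeg_component oO KS) /out_parity neq_mod2.
rewrite (deg_to_arcs _ _ oO) !oddD.
by case: (odd _); case: (odd _); case: (odd _); case: (odd _).
Qed.

Definition has_parities (V1 V2 : {set V}) O : Prop :=
  {in V1 :|: V2, forall v, odd (outdeg O v) = (v \in V1)}.

Lemma outdeg_in_window O V1 V2 x : orientation O -> has_parities V1 V2 O ->
  in_window V1 V2 x (outdeg O x).
Proof.
move=> oO parO.
have outE K : K \in processed V1 V2 x ->
    out_parity V1 x K = odd (arcs O [set x] K).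
  case/setIdP=> KS /subsetP sK; apply/esym/eqP.
  rewrite -odd_sum_outdeg_component //; apply/eqP/odd_sum_mem => v /sK.
  exact: parO.
have out_deg : outdeg O x = _ := outdeg_arcs_setC x oO.
rewrite -sum_arcs_components (sum_components_processed V1 V2) in out_deg.
split.
  rewrite trace_lE out_deg; apply: leq_trans (leq_addr _ _).
  by apply: leq_sum => K /outE->; lia.
rewrite trace_tE deg_components (sum_components_processed V1 V2) out_deg.
rewrite addnAC leq_add //; last first.
  by apply: leq_sum => K _; rewrite (deg_to_arcs _ _ oO) leq_addr.
rewrite -big_split; apply: leq_sum => K KP /=.
have := addb_out_in_parity V1 x K; rewrite outE // (deg_to_arcs _ _ oO) oddD.
by move/addbI->; lia.
Qed.

(* In a parity trace the vertex of [C] processed last is a pivot of [C]. *)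
Definition parity_pivot (V1 V2 C : {set V}) y : Prop :=
  forall O, orientation O -> {in (V1 :|: V2) :\ y, forall v, good H O v} ->
  {in C :\ y, forall v, odd (outdeg O v) = (v \in V1)} /\
  (odd (outdeg O y) = (y \in V1) <-> H y (outdeg O y)).

Definition parity_forced (V1 V2 : {set V}) : Prop :=
  forall C, C \subset V1 :|: V2 -> C != set0 ->
  exists2 y, y \in C & parity_pivot V1 V2 C y.

Lemma parity_pivot_good O V1 V2 C y : parity_pivot V1 V2 C y -> y \in C ->
  orientation O -> {in (V1 :|: V2) :\ y, forall v, good H O v} ->
  odd (\sum_(v in C) outdeg O v) = odd #|C :&: V1| -> good H O y.
Proof.
move=> pivot yC oO goodO sumO; have [parC good_y] := pivot O oO goodO.
exact/goodP/good_y/(odd_sum_mem_last yC parC).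
Qed.

Lemma parity_forced_has_parities O V1 V2 : parity_forced V1 V2 ->
  orientation O -> {in V1 :|: V2, forall v, good H O v} -> has_parities V1 V2 O.
Proof.
move=> forced oO goodO v vP.
have [||y /set1P-> pivot] := forced [set v]; rewrite ?sub1set //.
  by apply/set0Pn; exists v; rewrite inE.
have [|_ good_v] := pivot O oO; first by move=> u /setD1P[_ /goodO].
exact/good_v/goodP/goodO.
Qed.

Lemma has_parities_setU1_if O V1 V2 x p : has_parities V1 V2 O ->
  odd (outdeg O x) = p ->
  has_parities (setU1_if p x V1) (setU1_if (~~ p) x V2) O.
Proof.
move=> parO px v; rewrite setU1_if_setU in_setU1_if in_setU1.
have [->|_ /=] := eqVneq v x; last by rewrite andbF; exact: parO.
rewrite px andbT; case xV: (x \in V1); last by rewrite orbF.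
by rewrite -px parO ?inE ?xV ?orbT.
Qed.

Lemma parity_forced_setU1_if V1 V2 x p : parity_forced V1 V2 ->
  x \notin V1 :|: V2 ->
  (forall i, in_window V1 V2 x i -> H x i <-> odd i = p) ->
  parity_forced (setU1_if p x V1) (setU1_if (~~ p) x V2).
Proof.
move=> forced xP Hx C; rewrite setU1_if_setU => sC C0.
have in_odd v : v != x -> (v \in setU1_if p x V1) = (v \in V1).
  by move=> /negbTE vx; rewrite in_setU1_if vx andbF.
have xodd : (x \in setU1_if p x V1) = p.
  move: xP; rewrite in_setU1_if eqxx inE andbT => /norP[/negbTE-> _].
  by rewrite orbF.
have [xC|xC] := boolP (x \in C).
  exists x => // O oO; rewrite setU1_if_setU setU1K // => goodO.
  have parO := parity_forced_has_parities forced oO goodO.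
  rewrite xodd Hx; last exact: outdeg_in_window.
  split=> // v /setD1P[vx vC]; rewrite in_odd // parO //.
  by have /setU1P[/eqP|//] := subsetP sC v vC; rewrite (negbTE vx).
have [|y yC pivot] := forced C _ C0.
  apply/subsetP => v vC; have /setU1P[vx|//] := subsetP sC v vC.
  by rewrite vx (negbTE xC) in vC.
exists y => // O oO; rewrite setU1_if_setU => goodO.
have notx v : v \in C -> v != x by move=> vC; apply: contraNneq xC => <-.
have [v /setD1P[vy vP]|parC good_y] := pivot O oO.
  by apply: goodO; rewrite !inE vy -in_setU vP orbT.
rewrite in_odd ?notx //; split=> // v vC; have /setD1P[_ /notx vx] := vC.
by rewrite in_odd // parC.
Qed.

Hypothesis dH : dense H.
Let cG : connected G := proj1 dH.

(* Concentrating the badness of [K] at its pivot [y], and the badness outside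
   [K] at [x], makes every processed vertex other than [y] good. *)
Lemma realizable_processed V1 V2 x K j : parity_forced V1 V2 ->
  x \notin V1 :|: V2 -> K \in processed V1 V2 x -> j <= deg_to x K ->
  odd j = out_parity V1 x K -> realizable H x K j.
Proof.
move=> forced xP /setIdP[KS KP] le_j odd_j.
have [O oO outO] := exists_orientation_arcs le_j.
have [y yK pivot] := forced K KP (component_neq0 KS).
have [|O1 [oO1 eqO1 good1]] := @concentrate_bad _ H dH O K y oO.
  by move=> v vK; exact: component_connect KS _ _ vK yK.
have [|O2 [oO2 eqO2 good2]] := @concentrate_bad _ H dH O1 (~: K) x oO1.
  exact: setC_component_connect.
have eqK e : meets e K -> O2 e = O1 e.
  case/meetsP=> v ve vK; apply: eqO2; apply/subsetPn; exists v => //.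
  by rewrite inE vK.
have outO2 : arcs O2 [set x] K = j.
  rewrite -outO; apply: eq_arcs => // e /meetsP[w we /set1P wx] eK.
  rewrite eqK // eqO1 //; apply/subsetPn; exists x; first by rewrite -wx.
  exact: notin_component.
have goodK v : v \in K -> v != y -> good H O2 v.
  move=> vK vy; rewrite (eq_good H oO1 oO2) ?good1 ?in_setD1 ?vy // => e ve.
  exact/eqK/(mem_meets ve).
exists O2; split=> // v vK; have [->|/goodK->//] := eqVneq v y.
apply: (parity_pivot_good pivot) => // [u /setD1P[uy uP]|]; last first.
  by apply/eqP; rewrite (odd_sum_outdeg_component V1 oO2 KS) outO2 odd_j.
have [uK|uK] := boolP (u \in K); first exact: goodK.
by apply: good2; rewrite !inE uK andbT; apply: contraNneq xP => <-.
Qed.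

Lemma realizable_sum V1 V2 x b : parity_forced V1 V2 ->
  x \notin V1 :|: V2 -> trace_l V1 V2 x <= b ->
  b + trace_t V1 V2 x <= \sum_(K in processed V1 V2 x) deg_to x K ->
  odd b = odd (trace_l V1 V2 x) ->
  exists2 f : {set V} -> nat,
    {in processed V1 V2 x, forall K, realizable H x K (f K)} &
    \sum_(K in processed V1 V2 x) f K = b.
Proof.
rewrite trace_lE trace_tE => forced xP le_b b_le odd_b.
have bounds K : K \in processed V1 V2 x ->
    out_parity V1 x K + in_parity V1 K <= deg_to x K.
  by case/setIdP=> KS _; exact: out_in_parity_leq.
have degE : \sum_(K in processed V1 V2 x) deg_to x K =
    \sum_(K in processed V1 V2 x) (deg_to x K - in_parity V1 K) +
    \sum_(K in processed V1 V2 x) in_parity V1 K.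
  by rewrite -big_split; apply: eq_bigr => K /bounds /=; lia.
have [K KP|K KP||f fP sumf] := exists_sum_same_parity
  (A := processed V1 V2 x) (lo := fun K => out_parity V1 x K)
  (hi := fun K => deg_to x K - in_parity V1 K) _ _ _ odd_b.
- by have := bounds K KP; lia.
- by have := bounds K KP; have := addb_out_in_parity V1 x K; lia.
- by move: b_le; rewrite le_b degE leq_add2r.
exists f => // K KP; have [/andP[_ f_le] f_odd] := fP K KP.
apply: (realizable_processed forced xP KP); last by rewrite f_odd oddb.
exact: leq_trans f_le (leq_subr _ _).
Qed.

Lemma H_orientation_of_unprocessed V1 V2 x b (g : {set V} -> nat) :
  parity_forced V1 V2 -> x \notin V1 :|: V2 ->
  {in unprocessed V1 V2 x, forall K, realizable H x K (g K)} ->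
  trace_l V1 V2 x <= b ->
  b + trace_t V1 V2 x <= \sum_(K in processed V1 V2 x) deg_to x K ->
  odd b = odd (trace_l V1 V2 x) ->
  H x (b + \sum_(K in unprocessed V1 V2 x) g K) ->
  exists O, H_orientation H O.
Proof.
move=> forced xP realg le_b b_le odd_b Hx.
have [f realf sumf] := realizable_sum forced xP le_b b_le odd_b.
pose h K := if K \subset V1 :|: V2 then f K else g K.
apply: (@H_orientation_of_realizable _ _ x h).
  move=> K KS; rewrite /h; case: ifPn => KP; [apply: realf|apply: realg];
    by rewrite inE KS.
rewrite (sum_components_processed V1 V2).
rewrite (eq_bigr f) ?sumf => [|K /setIdP[_ KP]]; last by rewrite /h KP.
by rewrite (eq_bigr g) // => K /setIdP[_ /negbTE KP]; rewrite /h KP.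
Qed.

(* If all components are processed, the sum is empty, with predecessor 0. *)
Lemma realizable_unprocessed V1 V2 x j : #|unprocessed V1 V2 x| <= 1 ->
  j <= (\sum_(K in unprocessed V1 V2 x) deg_to x K).-1 ->
  exists2 g : {set V} -> nat,
    {in unprocessed V1 V2 x, forall K, realizable H x K (g K)} &
    j <= \sum_(K in unprocessed V1 V2 x) g K <= j.+1.
Proof.
have [->|/set0Pn[C CU]] := eqVneq (unprocessed V1 V2 x) set0.
  rewrite big_set0 leqn0 => _ /eqP->.
  by exists (fun=> 0) => [K|]; rewrite ?inE ?big_set0.
move=> un1; have <- : [set C] = unprocessed V1 V2 x.
  by apply/eqP; rewrite eqEcard sub1set CU cards1.
have /setIdP[CS _] := CU; have gt0 := deg_to_gt0 cG CS.
rewrite big_set1 => le_j; have lt_j : j < deg_to x C by lia.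
have [c bound_c realc] : exists2 c, j <= c <= j.+1 & realizable H x C c.
  have [|] := realizable_or_succ dH CS lt_j; last by exists j.+1 => //; lia.
  by exists j => //; lia.
by exists (fun=> c) => [K /set1P->|]; rewrite ?big_set1.
Qed.

Lemma H_orientation_of_consecutive V1 V2 x a : parity_forced V1 V2 ->
  x \notin V1 :|: V2 -> #|unprocessed V1 V2 x| <= 1 ->
  in_window V1 V2 x a -> in_window V1 V2 x a.+1 -> H x a -> H x a.+1 ->
  exists O, H_orientation H O.
Proof.
move=> forced xP un1 [le_a _] [_]; rewrite deg_components.
rewrite (sum_components_processed V1 V2) => a_le Ha HaS.
have lt_le := trace_sum_leq V1 V2 x cG; have lt_odd := odd_trace_sum V1 V2 x.
have orient := H_orientation_of_unprocessed forced xP.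
set l := trace_l V1 V2 x in le_a lt_le lt_odd orient.
set t := trace_t V1 V2 x in a_le lt_le lt_odd orient.
set D := \sum_(K in processed V1 V2 x) _ in a_le lt_le lt_odd orient.
have [|g realg bound_g] := @realizable_unprocessed V1 V2 x (a - (D - t)) un1.
  by lia.
set c := \sum_(K in _) g K in bound_g.
(* Of [a - c] and [a.+1 - c], the one congruent to [l] is in [l, D - t]. *)
have [same|differ] := eqVneq (odd (a + c)) (odd l).
  by apply: (orient (a - c) g realg); rewrite -/c ?subnK //; lia.
by apply: (orient (a.+1 - c) g realg); rewrite -/c ?subnK //; lia.
Qed.

Lemma H_orientation_of_all_processed V1 V2 : parity_forced V1 V2 ->
  V1 :|: V2 = setT -> odd #|V1| = odd (num_edges G) ->
  exists O, H_orientation H O.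
Proof.
move=> forced PT oddV; have [O0 oO0] := exists_orientation G.
have VT0 : [set: V] != set0.
  by case: cG => /card_gt0P[v _] _; apply/set0Pn; exists v; rewrite inE.
have [|y _ pivot] := forced setT _ VT0; first by rewrite PT.
have [|O [oO _ goodO]] := @concentrate_bad _ H dH O0 setT y oO0.
  by move=> v _; exact: connect_adj_inT.
exists O; split=> // v; apply/goodP.
have [->|vy] := eqVneq v y; last by apply: goodO; rewrite !inE vy.
apply: (parity_pivot_good pivot) => //; first by rewrite PT.
by rewrite sum_outdegT setTI.
Qed.

Lemma window_consecutive_or_parity V1 V2 x :
  (exists a, [/\ in_window V1 V2 x a, in_window V1 V2 x a.+1, H x a & H x a.+1])
  \/ exists p, forall i, in_window V1 V2 x i -> H x i <-> odd i = p.
Proof.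
case: (@no_gap_parity (H x) (trace_l V1 V2 x) (deg x - trace_t V1 V2 x)).
- by move=> i /andP[_ lt_i]; apply: (proj2 dH); lia.
- by case=> a [bounds_a Ha HaS]; left; exists a; split=> //; split; lia.
by case=> p Hp; right; exists p => i [? ?]; apply: Hp; lia.
Qed.

Lemma trace_steps_setU1_if p x xs V1 V2 W1 W2 :
  (forall i, in_window V1 V2 x i -> H x i -> odd i = p) ->
  trace_steps H (setU1_if p x V1) (setU1_if (~~ p) x V2) xs W1 W2 ->
  trace_steps H V1 V2 (x :: xs) W1 W2.
Proof.
case: p => oddH; [exact: trace_odd|apply: trace_even => i iw Hi].
by rewrite oddH.
Qed.

Lemma exists_parity_trace V1 V2 : ~ (exists O, H_orientation H O) ->
  parity_forced V1 V2 ->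
  exists xs W1 W2, [/\ uniq xs, xs =i ~: (V1 :|: V2),
    trace_steps H V1 V2 xs W1 W2 & odd #|W1| != odd (num_edges G)].
Proof.
move=> noO; have [n] := ubnP #|~: (V1 :|: V2)|.
elim: n V1 V2 => // n IH V1 V2 le_n forced.
have [PT|PT] := eqVneq (V1 :|: V2) setT.
  exists [::], V1, V2; split=> //; [|exact: trace_nil|].
    by move=> v; rewrite PT !inE.
  by apply/eqP => oddV; exact/noO/(H_orientation_of_all_processed forced).
have [x xP un1] := exists_extremal_vertex cG PT.
have [[a [aw aSw Ha HaS]]|[p Hp]] := window_consecutive_or_parity V1 V2 x.
  by case: noO; exact: (H_orientation_of_consecutive forced xP un1 aw aSw).
have RE : ~: (setU1_if p x V1 :|: setU1_if (~~ p) x V2) = ~: (V1 :|: V2) :\ x.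
  by rewrite setU1_if_setU setCU setIC -setDE.
have [||xs [W1 [W2 [uniq_xs xsE steps oddW]]]] :=
    IH (setU1_if p x V1) (setU1_if (~~ p) x V2).
- by move: le_n; rewrite RE (cardsD1 x) inE xP.
- exact: parity_forced_setU1_if.
exists (x :: xs), W1, W2; split=> //.
- by rewrite /= uniq_xs xsE RE in_setD1 eqxx.
- move=> v; rewrite inE xsE RE in_setD1.
  by case: eqVneq => // ->; rewrite inE xP.
by apply: trace_steps_setU1_if steps => i iw /(Hp i iw).
Qed.

Lemma init_parity i v : v \in V1_init H :|: V2_init H -> i <= deg v ->
  H v i <-> odd i = (v \in V1_init H).
Proof.
move=> vP le_i; have par k : k <= deg v -> H v k -> odd k = (v \in V1_init H).
  move=> le_k Hk; move: vP; rewrite !inE; case: asboolP => [[_ par] _|_ /=].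
    exact: par.
  by case/asboolP=> _ par; exact/negbTE/par.
have [j le_j Hj] : exists2 j, j <= deg v & H v j.
  by move: vP; rewrite !inE => /orP[]/asboolP[].
have [k /andP[_]|[k [k_lt Hk HkS]]|[p Hp]] := @no_gap_parity (H v) 0 (deg v).
- exact: (proj2 dH).
- have := par k.+1 k_lt HkS; rewrite oddS par ?(ltnW k_lt) //.
  by case: (_ \in _).
by rewrite Hp // -(par j le_j Hj) (proj1 (Hp j le_j) Hj).
Qed.

Lemma init_parity_forced : parity_forced (V1_init H) (V2_init H).
Proof.
move=> C sC /set0Pn[y yC]; exists y => // O oO goodO; split.
  move=> v /setD1P[vy vC]; have vP := subsetP sC v vC.
  apply/(init_parity vP (outdeg_leq_deg v oO))/goodP/goodO.
  by rewrite in_setD1 vy.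
by rewrite (init_parity (subsetP sC y yC) (outdeg_leq_deg y oO)).
Qed.

Lemma trace_steps_has_parities O V1 V2 xs W1 W2 : H_orientation H O ->
  trace_steps H V1 V2 xs W1 W2 -> has_parities V1 V2 O -> has_parities W1 W2 O.
Proof.
move=> [oO HO]; elim=> {V1 V2 xs W1 W2} // V1 V2 x xs W1 W2 oddH _ IH parO.
  have px := oddH _ (outdeg_in_window x oO parO) (HO x).
  apply: IH; exact: has_parities_setU1_if parO px.
have px := oddH _ (outdeg_in_window x oO parO) (HO x).
apply: IH; exact: has_parities_setU1_if parO (negbTE px).
Qed.

Lemma trace_steps_setU V1 V2 xs W1 W2 : trace_steps H V1 V2 xs W1 W2 ->
  W1 :|: W2 = V1 :|: V2 :|: [set:: xs].
Proof.
elim=> {V1 V2 xs W1 W2} [V1 V2|V1 V2 x xs W1 W2 _ _ ->|V1 V2 x xs W1 W2 _ _ ->].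
- by rewrite set_nil setU0.
- by rewrite set_cons [RHS]setUCA -!setUA.
- by rewrite set_cons [RHS]setUCA -!setUA setUCA.
Qed.

Lemma odd_parity_trace O xs W1 W2 : H_orientation H O ->
  parity_trace H xs W1 W2 -> odd #|W1| = odd (num_edges G).
Proof.
move=> HO [_ xsE steps]; have [oO goodO] := HO.
have WT : W1 :|: W2 = setT.
  rewrite (trace_steps_setU steps); apply/setP => v.
  by rewrite in_setU [X in _ || X]inE xsE in_setC orbN inE.
have parO : has_parities W1 W2 O.
  apply: (trace_steps_has_parities HO steps) => v vP.
  exact/(init_parity vP (outdeg_leq_deg v oO))/goodO.
rewrite -(sum_outdegT O) -(setTI W1); apply/esym/odd_sum_mem => v _.
by apply: parO; rewrite WT.
Qed.

End ParityTraces.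

Theorem theorem1p2 (G : graph) (H : vertex G -> nat -> Prop) :
  connected G -> dense H ->
  (exists O : edge G -> vertex G * vertex G, H_orientation H O) <->
  ~ (exists (xs : seq (vertex G)) (V1 V2 : {set vertex G}),
       parity_trace H xs V1 V2 /\ #|V1| <> num_edges G %[mod 2]).
Proof.
move=> _ dH; split=> [[O HO] [xs [W1 [W2 [trace []]]]]|notrace].
  by rewrite !modn2 (odd_parity_trace dH HO trace).
apply: contrapT => noO; apply: notrace.
have [xs [W1 [W2 [uniq_xs xsE steps oddW]]]] :=
  exists_parity_trace dH noO (init_parity_forced dH).
by exists xs, W1, W2; split=> //; rewrite !modn2; case: odd oddW; case: odd.
Qed.
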